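(* Let $\mathbb K$ be a field, $N\ge 2$ an integer, and let $\mathcal A=A(E,R)$, $\mathcal B=A(E',R')$, $\mathcal C=A(E'',R'')$ be $N$-homogeneous algebras over $\mathbb K$. The functorial isomorphism of finite-dimensional vector spaces $$\mathrm{Hom}_{\mathbb K}(E\otimes E',E'')=\mathrm{Hom}_{\mathbb K}(E,E'^*\otimes E'')$$ induces a corresponding functorial isomorphism $$\mathrm{Hom}(\mathcal A\bullet\mathcal B,\mathcal C)=\mathrm{Hom}(\mathcal A,\mathcal B^!\circ\mathcal C)$$ of sets of morphisms in the category $\mathbf H_N\mathbf{Alg}$ of $N$-homogeneous algebras.
   Context: $\otimes$ is the tensor product over $\mathbb K$. An $N$-homogeneous algebra is an algebra of the form $A(E,R)=T(E)/(R)$, where $E$ is a finite-dimensional $\mathbb K$-vector space, $R\subset E^{\otimes N}$ is a linear subspace, and $(R)$ is the two-sided ideal of the tensor algebra $T(E)$ generated by $R$. A morphism $f:A(E,R)\to A(E',R')$ is a linear map $f:E\to E'$ with $f^{\otimes N}(R)\subset R'$; $\mathrm{Hom}(\cdot,\cdot)$ denotes the set of such morphisms, which are therefore regarded as a subset of $\mathrm{Hom}_{\mathbb K}(E,E')$. These objects and morphisms form the category $\mathbf H_N\mathbf{Alg}$. The dual of $A(E,R)$ is $A(E,R)^!=A(E^*,R^\perp)$, where $R^\perp\subset (E^{\otimes N})^*=E^{*\otimes N}$ is the annihilator of $R$. For vector spaces $E,E'$ let $\pi_N:E^{\otimes N}\otimes E'^{\otimes N}\to (E\otimes E')^{\otimes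 N}$ be the linear isomorphism $e_1\otimes\cdots\otimes e_N\otimes e'_1\otimes\cdots\otimes e'_N\mapsto (e_1\otimes e'_1)\otimes\cdots\otimes(e_N\otimes e'_N)$. Set $$A(E,R)\circ A(E',R')=A\big(E\otimes E',\ \pi_N(R\otimes E'^{\otimes N}+E^{\otimes N}\otimes R')\big),\qquad A(E,R)\bullet A(E',R')=A\big(E\otimes E',\ \pi_N(R\otimes R')\big),$$ with $f\circ g$ and $f\bullet g$ both given on morphisms by the linear map $f\otimes g$. The functorial isomorphism of vector spaces in the claim is the canonical one (the Hom-tensor adjunction combined with $\mathrm{Hom}_{\mathbb K}(E',E'')=E'^*\otimes E''$). *)

(* Defs.v *)
From HB Require Import structures.
From mathcomp Require Import all_boot all_algebra.

Set Implicit Arguments.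
Unset Strict Implicit.
Unset Printing Implicit Defensive.

Import GRing.Theory.
Import VectorInternalTheory.
Local Open Scope ring_scope.

(* An element of tens U V is the matrix of its coordinates in the bases of U  *)
(* and V that are part of their vectType structures. All later definitions    *)
(* use tens only through the universal bilinear map tensor (written u *t v)   *)
(* and through tlift b, which is the unique linear map sending u *t v to      *)
(* b u v when b is bilinear (tensor_bilinear, tliftE, tens_ext).              *)
Section Tensor.
Variable K : fieldType.
Implicit Types U V W : vectType K.

Definition tens U V : vectType K := 'M[K]_(dim U, dim V).

Definition tensor U V (u : U) (v : V) : tens U V := (v2r u)^T *m v2r v.

Definition tlift U V W (b : U -> V -> W) : 'Hom(tens U V, W) :=
  linfun (fun M : 'M[K]_(dim U, dim V) =>
    \sum_i \sum_j M i j *: b (r2v (delta_mx 0 i)) (r2v (delta_mx 0 j))).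

Definition is_bilinear U V W (b : U -> V -> W) : Prop :=
  (forall u, linear (b u)) /\ (forall v, linear (b^~ v)).

Lemma linfun_linear U V (f : U -> V) : linear f -> linfun f =1 f.
Proof.
move=> lf; pose fL := GRing.isLinear.Build K U V *:%R f lf.
pose g : {linear U -> V} := HB.pack f fL.
exact: (lfunE g).
Qed.

Lemma linear_sumZ U V I (r : seq I) (f : U -> V) (c : I -> K) (x : I -> U) :
  linear f -> f (\sum_(i <- r) c i *: x i) = \sum_(i <- r) c i *: f (x i).
Proof.
move=> lf; rewrite -(linfun_linear lf) linear_sum.
by apply: eq_bigr => i _; rewrite linearZ /= linfun_linear.
Qed.

Lemma r2v_basis U (u : U) :
  u = \sum_i v2r u 0 i *: (r2v (delta_mx 0 i) : U).
Proof.
rewrite -[LHS]v2rK {1}[v2r u]row_sum_delta linear_sum /=.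
by apply: eq_bigr => i _; rewrite linearZ.
Qed.

Lemma tlift_linear U V W (b : U -> V -> W) :
  linear (fun M : 'M[K]_(dim U, dim V) =>
    \sum_i \sum_j M i j *: b (r2v (delta_mx 0 i)) (r2v (delta_mx 0 j))).
Proof.
move=> a M M'; rewrite scaler_sumr -big_split; apply: eq_bigr => i _ /=.
rewrite scaler_sumr -big_split; apply: eq_bigr => j _ /=.
by rewrite !mxE scalerDl scalerA.
Qed.

Lemma tensor_bilinear U V : is_bilinear (@tensor U V).
Proof.
split=> [u a v v'|v a u u']; rewrite /tensor.
  by rewrite linearP /= mulmxDr -scalemxAr.
by rewrite !linearP /= mulmxDl -scalemxAl.
Qed.

Lemma tliftE U V W (b : U -> V -> W) u v :
  is_bilinear b -> tlift b (tensor u v) = b u v.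
Proof.
case=> br bl; rewrite /tlift (linfun_linear (tlift_linear b)).
rewrite {2}[u]r2v_basis (linear_sumZ _ _ _ (bl v)); apply: eq_bigr => i _.
rewrite {2}[v]r2v_basis (linear_sumZ _ _ _ (br _)) scaler_sumr.
by apply: eq_bigr => j _; rewrite scalerA /tensor !mxE big_ord1 !mxE.
Qed.

Lemma tens_ext U V W (f g : 'Hom(tens U V, W)) :
  (forall u v, f (tensor u v) = g (tensor u v)) -> f = g.
Proof.
move=> fg; apply/lfunP => M; rewrite [M]matrix_sum_delta !linear_sum.
apply: eq_bigr => i _; rewrite !linear_sum; apply: eq_bigr => j _.
rewrite !linearZ /=; congr (_ *: _).
have -> : delta_mx i j = tensor (r2v (delta_mx 0 i)) (r2v (delta_mx 0 j)) :> tens U V.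
  by rewrite /tensor !r2vK trmx_delta mul_delta_mx.
exact: fg.
Qed.

End Tensor.

Notation "u *t v" := (tensor u v) (at level 40, left associativity).

Section LinearAlgebra.
Variable K : fieldType.
Implicit Types E F G U V W : vectType K.

Definition tmap U V U' V' (f : 'Hom(U, U')) (g : 'Hom(V, V')) :
    'Hom(tens U V, tens U' V') :=
  tlift (fun u v => f u *t g v).

(* A (x) B as a subspace of U (x) V *)
Definition tensv U V (A : {vspace U}) (B : {vspace V}) : {vspace tens U V} :=
  limg (tmap (linfun (vsval : subvs_of A -> U))
             (linfun (vsval : subvs_of B -> V))).

Definition dual V : vectType K := 'Hom(V, K^o).

Definition transpose V W (f : 'Hom(V, W)) : 'Hom(dual W, dual V) :=
  linfun (fun phi : 'Hom(W, K^o) => (phi \o f)%VF).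

Definition annih V (A : {vspace V}) : {vspace dual V} :=
  lker (linfun (fun phi : 'Hom(V, K^o) =>
    (phi \o linfun (vsval : subvs_of A -> V))%VF)).

Fixpoint tpow (n : nat) (E : vectType K) : vectType K :=
  if n is m.+1 then tens E (tpow m E) else K^o.

Fixpoint tpure (n : nat) (E : vectType K) : ('I_n -> E) -> tpow n E :=
  match n return ('I_n -> E) -> tpow n E with
  | 0 => fun _ => 1
  | m.+1 => fun e => e ord0 *t tpure (fun i => e (lift ord0 i))
  end.

Fixpoint tpow_map (n : nat) E F (f : 'Hom(E, F)) : 'Hom(tpow n E, tpow n F) :=
  match n return 'Hom(tpow n E, tpow n F) with
  | 0 => \1%VF
  | m.+1 => tmap f (tpow_map m f)
  end.

(* The isomorphism pi_n; see tpow_shuffle_pure. *)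
Fixpoint tpow_shuffle (n : nat) E F :
    'Hom(tens (tpow n E) (tpow n F), tpow n (tens E F)) :=
  match n return 'Hom(tens (tpow n E) (tpow n F), tpow n (tens E F)) with
  | 0 => tlift (fun a b : K^o => a * b : K^o)
  | m.+1 =>
      tlift (fun x y =>
        tlift (fun e s =>
          tlift (fun f t => (e *t f) *t tpow_shuffle m E F (s *t t)) y) x)
  end.

(* The identification of the n-th tensor power of the dual of E with the dual *)
(* of the n-th tensor power of E; see tpow_dual_pure.                         *)
Fixpoint tpow_dual (n : nat) E : 'Hom(tpow n (dual E), dual (tpow n E)) :=
  match n return 'Hom(tpow n (dual E), dual (tpow n E)) with
  | 0 => linfun (fun a : K^o => linfun (fun b : K^o => a * b : K^o))
  | m.+1 =>
      tlift (fun (phi : 'Hom(E, K^o)) w =>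
        tlift (fun e s => phi e * (tpow_dual m E w : 'Hom(_, K^o)) s : K^o))
  end.

(* phi *t v |-> (x |-> phi x *: v) *)
Definition tens_hom F G : 'Hom(tens (dual F) G, 'Hom(F, G)) :=
  tlift (fun (phi : 'Hom(F, K^o)) v => linfun (fun x : F => phi x *: v)).

(* The canonical map Hom(E (x) F, G) -> Hom(E, F^* (x) G); the right inverse  *)
(* of tens_hom used here is its inverse by tens_hom_bij.                      *)
Definition tcurry E F G :
    'Hom('Hom(tens E F, G), 'Hom(E, tens (dual F) G)) :=
  linfun (fun h : 'Hom(tens E F, G) =>
    linfun (fun e : E => (tens_hom F G)^-1%VF (linfun (fun x : F => h (e *t x))))).

Lemma linear_lfun V W (f : 'Hom(V, W)) : linear f.
Proof. by move=> a u v; rewrite linearP. Qed.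

Lemma tensor_linr U V (u : U) : linear (fun v : V => u *t v).
Proof. exact: (tensor_bilinear U V).1. Qed.

Lemma tensor_linl U V (v : V) : linear (fun u : U => u *t v).
Proof. exact: (tensor_bilinear U V).2. Qed.

Lemma tmap_bilinear U V U' V' (f : 'Hom(U, U')) (g : 'Hom(V, V')) :
  is_bilinear (fun u v => f u *t g v).
Proof.
split=> [u|v] a x y; rewrite linearP.
  exact: tensor_linr.
exact: (tensor_linl (g v)).
Qed.

Lemma tmapE U V U' V' (f : 'Hom(U, U')) (g : 'Hom(V, V')) u v :
  tmap f g (u *t v) = f u *t g v.
Proof. exact: (tliftE _ _ (tmap_bilinear f g)). Qed.

Lemma tmap_comp U V U' V' U'' V'' (f' : 'Hom(U', U'')) (g' : 'Hom(V', V''))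
    (f : 'Hom(U, U')) (g : 'Hom(V, V')) :
  tmap (f' \o f)%VF (g' \o g)%VF = (tmap f' g' \o tmap f g)%VF.
Proof. by apply: tens_ext => u v; rewrite comp_lfunE !tmapE !comp_lfunE. Qed.

Lemma tmap_id U V : tmap (\1 : 'Hom(U, U))%VF (\1 : 'Hom(V, V))%VF = \1%VF.
Proof. by apply: tens_ext => u v; rewrite tmapE !id_lfunE. Qed.

Lemma vsval_lfunE V (A : {vspace V}) (x : subvs_of A) :
  linfun (vsval : subvs_of A -> V) x = vsval x.
Proof. by apply: linfun_linear => a y z; rewrite linearP. Qed.

Lemma limg_tens_sub U V W (f : 'Hom(tens U V, W)) (C : {vspace W}) :
  (forall u v, f (u *t v) \in C) -> (limg f <= C)%VS.
Proof.
move=> fC; apply/subvP => _ /memv_imgP[M _ ->].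
rewrite [M]matrix_sum_delta linear_sum memv_suml // => i _.
rewrite linear_sum memv_suml // => j _; rewrite linearZ memvZ //.
have -> : delta_mx i j = r2v (delta_mx 0 i) *t r2v (delta_mx 0 j) :> tens U V.
  by rewrite /tensor !r2vK trmx_delta mul_delta_mx.
exact: fC.
Qed.

Lemma memv_tens U V (A : {vspace U}) (B : {vspace V}) u v :
  u \in A -> v \in B -> u *t v \in tensv A B.
Proof.
move=> uA vB; apply/memv_imgP; exists (vsproj A u *t vsproj B v) => //.
  exact: memvf.
by rewrite tmapE !vsval_lfunE !vsprojK.
Qed.

Lemma tensv_sub U V (A : {vspace U}) (B : {vspace V}) (C : {vspace tens U V}) :
  (forall u v, u \in A -> v \in B -> u *t v \in C) -> (tensv A B <= C)%VS.
Proof.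
move=> sAB; apply: limg_tens_sub => u v.
by rewrite tmapE !vsval_lfunE sAB ?subvsP.
Qed.

Lemma transposeE V W (f : 'Hom(V, W)) (phi : 'Hom(W, K^o)) x :
  (transpose f phi : 'Hom(V, K^o)) x = phi (f x).
Proof.
rewrite /transpose linfun_linear ?comp_lfunE // => a p q.
by apply/lfunP => y; rewrite !(comp_lfunE, add_lfunE, scale_lfunE).
Qed.

Lemma annihP V (A : {vspace V}) (phi : 'Hom(V, K^o)) :
  reflect (forall x, x \in A -> phi x = 0) (phi \in annih A).
Proof.
rewrite memv_ker linfun_linear; last first.
  by move=> a p q; apply/lfunP => y; rewrite !(comp_lfunE, add_lfunE, scale_lfunE).
apply: (iffP eqP) => [/lfunP h x xA|h].
  by have := h (Subvs xA); rewrite comp_lfunE vsval_lfunE lfunE.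
by apply/lfunP => y; rewrite comp_lfunE vsval_lfunE lfunE /= h ?subvsP.
Qed.

Lemma tpow_map_comp n E F G (g : 'Hom(F, G)) (f : 'Hom(E, F)) :
  tpow_map n (g \o f)%VF = (tpow_map n g \o tpow_map n f)%VF.
Proof. by elim: n => [|n IH] /=; [rewrite comp_lfun1l | rewrite IH tmap_comp]. Qed.

Lemma tpow_map_id n E : tpow_map n (\1 : 'Hom(E, E))%VF = \1%VF.
Proof. by elim: n => //= n ->; rewrite tmap_id. Qed.

Lemma tpow_mapS n E F (f : 'Hom(E, F)) e s :
  tpow_map n.+1 f (e *t s) = f e *t tpow_map n f s.
Proof. exact: tmapE. Qed.

Lemma tpow_map_pure n E F (f : 'Hom(E, F)) (e : 'I_n -> E) :
  tpow_map n f (tpure e) = tpure (fun i => f (e i)).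
Proof. by elim: n e => [|n IH] e /=; rewrite ?id_lfunE // tmapE IH. Qed.

Lemma tliftP U V W (b : U -> V -> W) x :
  tlift b x = \sum_i \sum_j (x : 'M_(dim U, dim V)) i j *:
                b (r2v (delta_mx 0 i)) (r2v (delta_mx 0 j)).
Proof. by rewrite /tlift (linfun_linear (tlift_linear b)). Qed.

Lemma tlift_funD U V W (c : K) (b1 b2 b3 : U -> V -> W) x :
  (forall u v, b1 u v = c *: b2 u v + b3 u v) ->
  tlift b1 x = c *: tlift b2 x + tlift b3 x.
Proof.
move=> h; rewrite !tliftP scaler_sumr -big_split; apply: eq_bigr => i _ /=.
rewrite scaler_sumr -big_split; apply: eq_bigr => j _ /=.
by rewrite h scalerDr !scalerA [_ * c]mulrC.
Qed.

Lemma tpow_shuffleS n E F (e : E) (s : tpow n E) (f : F) (t : tpow n F) :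
  tpow_shuffle n.+1 E F ((e *t s) *t (f *t t)) =
  (e *t f) *t tpow_shuffle n E F (s *t t).
Proof.
rewrite /= tliftE; last first.
  split=> [x a y y'|y a x x']; last exact: linear_lfun.
  by apply: tlift_funD => u v; exact: linear_lfun.
rewrite tliftE; last first.
  split=> [u a v v'|v a u u']; apply: tlift_funD => u1 v1.
    by rewrite tensor_linl linear_lfun tensor_linr.
  by rewrite tensor_linl (tensor_linl (_ : tpow n (tens E F))).
rewrite tliftE //.
split=> [u a v v'|v a u u'].
  by rewrite tensor_linr linear_lfun tensor_linr.
by rewrite tensor_linr (tensor_linl (_ : tpow n (tens E F))).
Qed.

Lemma tpow_shuffle0 E F (a b : K^o) : tpow_shuffle 0 E F (a *t b) = a * b :> K^o.
Proof.
rewrite /= tliftE //; split=> [u c v v'|v c u u'].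
  by rewrite mulrDr scalerAr.
by rewrite mulrDl scalerAl.
Qed.

Lemma tpow_shuffle_pure n E F (e : 'I_n -> E) (f : 'I_n -> F) :
  tpow_shuffle n E F (tpure e *t tpure f) = tpure (fun i => e i *t f i).
Proof.
elim: n e f => [|n IH] e f; last by rewrite tpow_shuffleS IH.
by rewrite tpow_shuffle0 mulr1.
Qed.

Lemma tpow_dual0 E (a : K^o) (b : K^o) :
  (tpow_dual 0 E a : 'Hom(K^o, K^o)) b = a * b.
Proof.
have L (c : K^o) : linear (fun b : K^o => c * b : K^o).
  by move=> k x y; rewrite mulrDr scalerAr.
rewrite /= (linfun_linear (f := fun a : K^o => linfun _)) ?linfun_linear //.
move=> k x y; apply/lfunP => z.
by rewrite !(add_lfunE, scale_lfunE, linfun_linear) // mulrDl scalerAl.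
Qed.

Lemma tpow_dualS n E (phi : dual E) (w : tpow n (dual E)) (e : E) (s : tpow n E) :
  (tpow_dual n.+1 E (phi *t w) : 'Hom(tens E (tpow n E), K^o)) (e *t s) =
  (phi : 'Hom(E, K^o)) e * (tpow_dual n E w : 'Hom(tpow n E, K^o)) s.
Proof.
rewrite /= tliftE; last first.
  split=> [p a w1 w2|w1 a p p'];
    apply/lfunP => x; rewrite !(add_lfunE, scale_lfunE);
    apply: tlift_funD => u v.
    by rewrite linear_lfun add_lfunE scale_lfunE mulrDr scalerAr.
  by rewrite add_lfunE scale_lfunE mulrDl scalerAl.
rewrite tliftE //; split=> [u a v v'|v a u u'].
  by rewrite linear_lfun mulrDr scalerAr.
by rewrite linear_lfun mulrDl scalerAl.
Qed.

Lemma tpow_dual_pure n E (phi : 'I_n -> dual E) (e : 'I_n -> E) :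
  (tpow_dual n E (tpure phi) : 'Hom(tpow n E, K^o)) (tpure e) =
  \prod_i (phi i : 'Hom(E, K^o)) (e i).
Proof.
elim: n phi e => [|n IH] phi e; first by rewrite tpow_dual0 big_ord0 mulr1.
by rewrite tpow_dualS IH big_ord_recl.
Qed.

Lemma tens_homE F G (phi : 'Hom(F, K^o)) (v : G) x :
  tens_hom F G ((phi : dual F) *t v) x = phi x *: v.
Proof.
have L (p : 'Hom(F, K^o)) (u : G) : linear (fun x : F => p x *: u).
  by move=> a y z; rewrite linearP scalerDl -scalerA.
rewrite /tens_hom tliftE ?linfun_linear //; split=> [p a u u'|u a p p'];
  apply/lfunP => y; rewrite !(add_lfunE, scale_lfunE, linfun_linear) //.
  by rewrite scalerDr !scalerA mulrC.
by rewrite scalerDl -scalerA.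
Qed.

Lemma tens_hom_bij F G : bijective (tens_hom F G).
Proof.
pose d i : dual F := linfun (fun x : F => v2r x 0 i : K^o).
have dE i x : (d i : 'Hom(F, K^o)) x = v2r x 0 i.
  by apply: linfun_linear => a y z; rewrite linearP !mxE.
pose b i : F := r2v (delta_mx 0 i).
pose inv (h : 'Hom(F, G)) : tens (dual F) G := \sum_i d i *t h (b i).
have invK h : tens_hom F G (inv h) = h.
  apply/lfunP => x; rewrite /inv linear_sum sum_lfunE [in RHS](r2v_basis x).
  by rewrite linear_sum; apply: eq_bigr => i _; rewrite tens_homE dE linearZ.
have inv_lin : linear inv.
  move=> a h h'; rewrite /inv scaler_sumr -big_split; apply: eq_bigr => i _.
  by rewrite add_lfunE scale_lfunE tensor_linr.
exists inv => // x.
have /lfunP/(_ x) : (linfun inv \o tens_hom F G)%VF = \1%VF.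
  apply: tens_ext => phi v; rewrite comp_lfunE id_lfunE linfun_linear //.
  have {2}-> : phi = \sum_i (phi : 'Hom(F, K^o)) (b i) *: d i.
    apply/lfunP => y; rewrite sum_lfunE {1}[y]r2v_basis linear_sum.
    by apply: eq_bigr => i _; rewrite linearZ scale_lfunE dE; exact: mulrC.
  rewrite (linear_sumZ _ _ _ (tensor_linl v)); apply: eq_bigr => i _.
  by rewrite tens_homE -(linfun_linear (tensor_linr (d i))) linearZ /=
             linfun_linear //; exact: tensor_linr.
by rewrite comp_lfunE id_lfunE linfun_linear.
Qed.

(* The defining property of tcurry; tens_hom F G being bijective, it          *)
(* determines tcurry E F G.                                                   *)
Lemma tcurryE E F G (h : 'Hom(tens E F, G)) e x :
  tens_hom F G (tcurry E F G h e) x = h (e *t x).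
Proof.
have L2 (k : 'Hom(tens E F, G)) (e' : E) : linear (fun x : F => k (e' *t x)).
  by move=> a y z; rewrite tensor_linr linear_lfun.
have L1 (k : 'Hom(tens E F, G)) : linear (fun e : E =>
    (tens_hom F G)^-1%VF (linfun (fun x : F => k (e *t x)))).
  move=> a y z; rewrite -linear_lfun; congr (_ _); apply/lfunP => t.
  by rewrite add_lfunE scale_lfunE !linfun_linear // tensor_linl linear_lfun.
have invK : cancel (tens_hom F G)^-1%VF (tens_hom F G).
  have [g fK gK] := tens_hom_bij F G; move=> y; apply: limg_lfunVK.
  by rewrite -[y]gK memv_img ?memvf.
have L0 : linear (fun k : 'Hom(tens E F, G) => linfun (fun e : E =>
    (tens_hom F G)^-1%VF (linfun (fun x : F => k (e *t x))))).
  move=> a k k'; apply/lfunP => y; rewrite add_lfunE scale_lfunE.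
  rewrite (linfun_linear (L1 _)) (linfun_linear (L1 k)) (linfun_linear (L1 k')).
  rewrite -linear_lfun; congr (_ _); apply/lfunP => t.
  by rewrite add_lfunE scale_lfunE !(linfun_linear (L2 _ _)) add_lfunE scale_lfunE.
rewrite /tcurry (linfun_linear L0) (linfun_linear (L1 h)) invK.
exact: (linfun_linear (L2 h e)).
Qed.

Lemma tpow_dual_transpose n E F (f : 'Hom(E, F)) (w : tpow n (dual F)) x :
  (tpow_dual n E (tpow_map n (transpose f) w) : 'Hom(tpow n E, K^o)) x =
  (tpow_dual n F w : 'Hom(tpow n F, K^o)) (tpow_map n f x).
Proof.
suff H : (tpow_dual n E \o tpow_map n (transpose f))%VF =
         (transpose (tpow_map n f) \o tpow_dual n F)%VF.
  by have /lfunP/(_ w) := H; rewrite !comp_lfunE => ->; rewrite transposeE.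
elim: n {w x} => [|n IH].
  apply/lfunP => a; rewrite !comp_lfunE; apply/lfunP => b.
  by rewrite transposeE !id_lfunE.
apply: tens_ext => phi w; rewrite !comp_lfunE; apply: tens_ext => e s.
rewrite transposeE tmapE tpow_dualS tmapE tpow_dualS transposeE.
by have /lfunP/(_ w) := IH; rewrite !comp_lfunE => ->; rewrite transposeE.
Qed.

Lemma tens_ext4 A B C D W (l r : 'Hom(tens (tens A B) (tens C D), W)) :
  (forall a b c d, l ((a *t b) *t (c *t d)) = r ((a *t b) *t (c *t d))) ->
  l = r.
Proof.
move=> lr; apply: tens_ext => x y.
have Ll (k : 'Hom(tens (tens A B) (tens C D), W)) v : linear (fun u => k (u *t v)).
  by move=> a p q; rewrite tensor_linl linear_lfun.
have Lr (k : 'Hom(tens (tens A B) (tens C D), W)) u : linear (fun v => k (u *t v)).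
  by move=> a p q; rewrite tensor_linr linear_lfun.
rewrite -(linfun_linear (Ll l y)) -(linfun_linear (Ll r y)).
congr (fun_of_lfun _ x); apply: tens_ext => a b.
rewrite (linfun_linear (Ll l y)) (linfun_linear (Ll r y)).
rewrite -(linfun_linear (Lr l (a *t b))) -(linfun_linear (Lr r (a *t b))).
congr (fun_of_lfun _ y); apply: tens_ext => c d.
by rewrite (linfun_linear (Lr l _)) (linfun_linear (Lr r _)).
Qed.

Lemma tpow_shuffle_map n E F E' F' (f : 'Hom(E, E')) (g : 'Hom(F, F')) :
  (tpow_map n (tmap f g) \o tpow_shuffle n E F)%VF =
  (tpow_shuffle n E' F' \o tmap (tpow_map n f) (tpow_map n g))%VF.
Proof.
elim: n => [|n IH].
  apply: tens_ext => a b.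
  by rewrite !comp_lfunE tmapE [tpow_map _ _]/= !id_lfunE.
apply: tens_ext4 => e s u t.
rewrite !comp_lfunE tpow_shuffleS tpow_mapS tmapE.
rewrite [in RHS]tmapE !tpow_mapS tpow_shuffleS.
by have /lfunP/(_ (s *t t)) := IH; rewrite !comp_lfunE tmapE => ->.
Qed.

End LinearAlgebra.

(* HAlg E R is the N-homogeneous algebra A(E, R) = T(E) / (R), given by its   *)
(* space of generators E and its space of relations R. Morphisms, the dual    *)
(* and both products are all defined on the pair (E, R).                      *)
Record halg (K : fieldType) (N : nat) := HAlg {
  hgen : vectType K;
  hrel : {vspace tpow N hgen}
}.

Section HomogeneousAlgebras.
Variables (K : fieldType) (N : nat).
Implicit Types A B C D : halg K N.

Definition is_halg_hom A B (f : 'Hom(hgen A, hgen B)) : bool :=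
  (tpow_map N f @: hrel A <= hrel B)%VS.

Record halg_hom A B := HalgHom {
  hfun :> 'Hom(hgen A, hgen B);
  hfunP : is_halg_hom hfun
}.

HB.instance Definition _ A B := [isSub of halg_hom A B for @hfun A B].

Lemma is_halg_homP A B (f : 'Hom(hgen A, hgen B)) :
  reflect (forall x, x \in hrel A -> tpow_map N f x \in hrel B)
          (is_halg_hom f).
Proof.
apply: (iffP subvP) => [h x xA|h _ /memv_imgP[x xA ->]]; last exact: h.
by rewrite h // memv_img.
Qed.

Lemma hid_subproof A : is_halg_hom (\1 : 'Hom(hgen A, hgen A))%VF.
Proof. by apply/is_halg_homP => x; rewrite tpow_map_id id_lfunE. Qed.
Definition hid A : halg_hom A A := HalgHom (hid_subproof A).

Lemma hcomp_subproof A B C (g : halg_hom B C) (f : halg_hom A B) :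
  is_halg_hom (hfun g \o hfun f)%VF.
Proof.
apply/is_halg_homP => x xA; rewrite tpow_map_comp comp_lfunE.
exact/(is_halg_homP _ (hfunP g))/(is_halg_homP _ (hfunP f)).
Qed.
Definition hcomp A B C (g : halg_hom B C) (f : halg_hom A B) : halg_hom A C :=
  HalgHom (hcomp_subproof g f).

Definition hdual A : halg K N :=
  HAlg (tpow_dual N (hgen A) @^-1: annih (hrel A))%VS.

Definition hcirc A B : halg K N :=
  @HAlg K N (tens (hgen A) (hgen B))
    (tpow_shuffle N (hgen A) (hgen B) @:
      (tensv (hrel A) fullv + tensv fullv (hrel B)))%VS.

Definition hbullet A B : halg K N :=
  @HAlg K N (tens (hgen A) (hgen B))
    (tpow_shuffle N (hgen A) (hgen B) @: tensv (hrel A) (hrel B))%VS.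

Lemma hdual_map_subproof A B (f : halg_hom A B) :
  @is_halg_hom (hdual B) (hdual A) (transpose (hfun f)).
Proof.
apply/is_halg_homP => w; rewrite -!memv_preim => /annihP wB.
apply/annihP => x xA; rewrite tpow_dual_transpose wB //.
exact: (is_halg_homP _ (hfunP f)).
Qed.
Definition hdual_map A B (f : halg_hom A B) : halg_hom (hdual B) (hdual A) :=
  HalgHom (hdual_map_subproof f).

Lemma shuffle_hom A B A' B' (f : halg_hom A A') (g : halg_hom B B')
    (S : {vspace tens (tpow N (hgen A)) (tpow N (hgen B))})
    (S' : {vspace tens (tpow N (hgen A')) (tpow N (hgen B'))}) :
  (S <= tmap (tpow_map N f) (tpow_map N g) @^-1: S')%VS ->
  forall x, x \in (tpow_shuffle N (hgen A) (hgen B) @: S)%VS ->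
  tpow_map N (tmap f g) x \in (tpow_shuffle N (hgen A') (hgen B') @: S')%VS.
Proof.
move=> /subvP sS _ /memv_imgP[x xS ->].
have /lfunP/(_ x) := tpow_shuffle_map N f g; rewrite !comp_lfunE => ->.
by rewrite memv_img //; have := sS _ xS; rewrite -memv_preim.
Qed.

Lemma hcirc_map_subproof A B A' B' (f : halg_hom A A') (g : halg_hom B B') :
  @is_halg_hom (hcirc A B) (hcirc A' B') (tmap f g).
Proof.
apply/is_halg_homP; apply: shuffle_hom; rewrite subv_add; apply/andP; split.
  apply: tensv_sub => u v uA _; rewrite -memv_preim tmapE.
  apply: (subvP (addvSl _ _)); apply: memv_tens; last exact: memvf.
  exact: (is_halg_homP _ (hfunP f)).
apply: tensv_sub => u v _ vB; rewrite -memv_preim tmapE.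
apply: (subvP (addvSr _ _)); apply: memv_tens; first exact: memvf.
exact: (is_halg_homP _ (hfunP g)).
Qed.
Definition hcirc_map A B A' B' (f : halg_hom A A') (g : halg_hom B B') :
    halg_hom (hcirc A B) (hcirc A' B') :=
  HalgHom (hcirc_map_subproof f g).

Lemma hbullet_map_subproof A B A' B' (f : halg_hom A A') (g : halg_hom B B') :
  @is_halg_hom (hbullet A B) (hbullet A' B') (tmap f g).
Proof.
apply/is_halg_homP; apply: shuffle_hom.
apply: tensv_sub => u v uA vB; rewrite -memv_preim tmapE.
by rewrite memv_tens ?(is_halg_homP _ (hfunP f)) ?(is_halg_homP _ (hfunP g)).
Qed.
Definition hbullet_map A B A' B' (f : halg_hom A A') (g : halg_hom B B') :
    halg_hom (hbullet A B) (hbullet A' B') :=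
  HalgHom (hbullet_map_subproof f g).

Lemma hcompA A B C D (h : halg_hom C D) (g : halg_hom B C) (f : halg_hom A B) :
  hcomp h (hcomp g f) = hcomp (hcomp h g) f.
Proof. by apply: val_inj; rewrite /= comp_lfunA. Qed.

Lemma hcomp1l A B (f : halg_hom A B) : hcomp (hid B) f = f.
Proof. by apply: val_inj; rewrite /= comp_lfun1l. Qed.

Lemma hcomp1r A B (f : halg_hom A B) : hcomp f (hid A) = f.
Proof. by apply: val_inj; rewrite /= comp_lfun1r. Qed.

Lemma hdual_map_comp A B C (g : halg_hom B C) (f : halg_hom A B) :
  hdual_map (hcomp g f) = hcomp (hdual_map f) (hdual_map g).
Proof.
apply: val_inj; apply/lfunP => phi; rewrite /= comp_lfunE.
by apply/lfunP => x; rewrite !transposeE comp_lfunE.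
Qed.

Lemma hcirc_map_comp A B A' B' A'' B'' (f' : halg_hom A' A'')
    (g' : halg_hom B' B'') (f : halg_hom A A') (g : halg_hom B B') :
  hcirc_map (hcomp f' f) (hcomp g' g) =
  hcomp (hcirc_map f' g') (hcirc_map f g).
Proof. by apply: val_inj; rewrite /= tmap_comp. Qed.

Lemma hbullet_map_comp A B A' B' A'' B'' (f' : halg_hom A' A'')
    (g' : halg_hom B' B'') (f : halg_hom A A') (g : halg_hom B B') :
  hbullet_map (hcomp f' f) (hcomp g' g) =
  hcomp (hbullet_map f' g') (hbullet_map f g).
Proof. by apply: val_inj; rewrite /= tmap_comp. Qed.

End HomogeneousAlgebras.

(* Main.v *)
From HB Require Import structures.
From mathcomp Require Import all_boot all_algebra.
Require Import Defs.

(* Let ev : (F^* (x) G) (x) F -> G be the evaluation. A map h : E (x) F -> G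
   and the map g : E -> F^* (x) G corresponding to it satisfy
   h = ev \o (g (x) id), so that by naturality of pi_N
     h^N (pi_N (r (x) t)) = ev^N (pi_N (g^N r (x) t)).
   Writing g^N r = pi_N z, the right-hand side is the value at t of the image
   of z in Hom (F^N, G^N). Both morphism conditions then agree because the
   linear maps V -> W sending A into B correspond to the tensors in
   A^perp (x) W + V^* (x) B, as one sees by splitting such a map along a
   projection of V onto A. *)

Set Implicit Arguments.
Unset Strict Implicit.
Unset Printing Implicit Defensive.

Import GRing.Theory.
Local Open Scope ring_scope.

Section TensorMaps.
Variable K : fieldType.
Implicit Types E F G U V W : vectType K.

(** * Bijections, spanning and extensionality for tensor products *)

Lemma bijective_lfun V W (f : 'Hom(V, W)) :
  bijective f -> {g : 'Hom(W, V) | cancel f g & cancel g f}.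
Proof.
move=> bij_f; exists f^-1%VF => x.
  by apply: lker0_lfunK; apply/lker0P; apply: bij_inj.
by apply: limg_lfunVK; case: bij_f => g _ gK; rewrite -[x]gK memv_img ?memvf.
Qed.

Lemma tmap_cancel U V U' V' (f : 'Hom(U, U')) (g : 'Hom(V, V'))
    (f' : 'Hom(U', U)) (g' : 'Hom(V', V)) :
  cancel f f' -> cancel g g' -> cancel (tmap f g) (tmap f' g').
Proof.
move=> fK gK x; rewrite -comp_lfunE -[RHS]id_lfunE; congr (fun_of_lfun _ x).
by apply: tens_ext => u v; rewrite comp_lfunE !tmapE fK gK id_lfunE.
Qed.

Lemma tmap_bij U V U' V' (f : 'Hom(U, U')) (g : 'Hom(V, V')) :
  bijective f -> bijective g -> bijective (tmap f g).
Proof.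
move=> /bijective_lfun[f' fK f'K] /bijective_lfun[g' gK g'K].
by exists (tmap f' g'); apply: tmap_cancel.
Qed.

Lemma tensorZ U V (a b : K) (u : U) (v : V) :
  (a *: u) *t (b *: v) = (a * b) *: (u *t v).
Proof.
rewrite -(linfun_linear (tensor_linl (b *: v))) linearZ /= linfun_linear; last first.
  exact: tensor_linl.
rewrite -(linfun_linear (tensor_linr u)) linearZ /= linfun_linear; last first.
  exact: tensor_linr.
by rewrite -scalerA.
Qed.

(** Pure tensors span. Applied to a preimage of a subspace, this reduces a membership claim about
    arbitrary tensors to pure ones. *)
Lemma mem_tens U V (C : {vspace tens U V}) x :
  (forall u v, u *t v \in C) -> x \in C.
Proof.
move=> pureC; have: (limg (\1 : 'End(tens U V)) <= C)%VS.
  by apply: limg_tens_sub => u v; rewrite id_lfunE.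
by rewrite lim1g => /subvP->; rewrite ?memvf.
Qed.

(** This supplies the [z] with g^N r = pi_N z. In the induction step the tail is in the image by
    hypothesis, and the remaining factors may then be taken pure, where [tpow_shuffleS] exhibits the
    preimage. *)
Lemma tpow_shuffle_surj n E F : limg (tpow_shuffle n E F) = fullv.
Proof.
apply/vspaceP => x; rewrite memvf; elim: n x => [|n IH] x.
  apply/memv_imgP; exists ((1 : K^o) *t (x : K^o)); rewrite ?memvf //.
  by rewrite tpow_shuffle0 mul1r.
apply: mem_tens => y z; have /memv_imgP[w _ ->] := IH z.
set C := limg _.
(* Written as the value of a linear map at [y], the tensor lies in [C] exactly when [y] lies in a
   preimage of [C], to which [mem_tens] applies. *)
have -> : y *t tpow_shuffle n E F w =
    linfun (fun y : tens E F => y *t tpow_shuffle n E F w) y.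
  by rewrite linfun_linear //; apply: tensor_linl.
rewrite memv_preim; apply: mem_tens => e f; rewrite -memv_preim.
rewrite linfun_linear; last exact: tensor_linl.
have -> : (e *t f) *t tpow_shuffle n E F w =
    (linfun (fun z : tpow n (tens E F) => (e *t f) *t z) \o
       tpow_shuffle n E F)%VF w.
  by rewrite comp_lfunE linfun_linear //; apply: tensor_linr.
rewrite memv_preim; apply: mem_tens => s t; rewrite -memv_preim comp_lfunE.
rewrite linfun_linear; last exact: tensor_linr.
by rewrite -tpow_shuffleS memv_img ?memvf.
Qed.

Lemma tens_ext3 A B C W (l r : 'Hom(tens (tens A B) C, W)) :
  (forall a b c, l ((a *t b) *t c) = r ((a *t b) *t c)) -> l = r.
Proof.
move=> lr; apply: tens_ext => x c.
have L (k : 'Hom(tens (tens A B) C, W)) : linear (fun u => k (u *t c)).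
  by move=> a p q; rewrite tensor_linl linear_lfun.
rewrite -(linfun_linear (L l)) -(linfun_linear (L r)).
by congr (fun_of_lfun _ x); apply: tens_ext => a b; rewrite !linfun_linear.
Qed.

(** The six factors are those of the induction step of [tens_eval_tpow], where three tensor powers
    are each split into head and tail. *)
Lemma tens_ext6 A B C D E F W
    (l r : 'Hom(tens (tens (tens A B) (tens C D)) (tens E F), W)) :
  (forall a b c d e f,
     l (((a *t b) *t (c *t d)) *t (e *t f)) =
     r (((a *t b) *t (c *t d)) *t (e *t f))) ->
  l = r.
Proof.
move=> lr; apply: tens_ext => x y.
pose X := tens (tens (tens A B) (tens C D)) (tens E F).
have Ll (k : 'Hom(X, W)) v : linear (fun u => k (u *t v)).
  by move=> a p q; rewrite tensor_linl linear_lfun.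
have Lr (k : 'Hom(X, W)) u : linear (fun v => k (u *t v)).
  by move=> a p q; rewrite tensor_linr linear_lfun.
rewrite -(linfun_linear (Ll l y)) -(linfun_linear (Ll r y)).
congr (fun_of_lfun _ x); apply: tens_ext4 => a b c d.
rewrite !linfun_linear // -(linfun_linear (Lr l _)) -(linfun_linear (Lr r _)).
congr (fun_of_lfun _ y); apply: tens_ext => e f.
by rewrite !linfun_linear.
Qed.

(** * Evaluation, uncurrying and naturality *)

Definition tens_eval F G : 'Hom(tens (tens (dual F) G) F, G) :=
  tlift (fun z x => tens_hom F G z x).

Lemma tens_evalE F G z x : tens_eval F G (z *t x) = tens_hom F G z x.
Proof.
apply: tliftE; split=> [u|v] a y y'; first exact: linear_lfun.
by rewrite linear_lfun add_lfunE scale_lfunE.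
Qed.

Definition tuncurry E F G (g : 'Hom(E, tens (dual F) G)) : 'Hom(tens E F, G) :=
  (tens_eval F G \o tmap g \1)%VF.

Lemma tuncurryE E F G (g : 'Hom(E, tens (dual F) G)) e x :
  tuncurry g (e *t x) = tens_hom F G (g e) x.
Proof. by rewrite comp_lfunE tmapE tens_evalE id_lfunE. Qed.

Lemma tcurryK E F G : cancel (tcurry E F G) (@tuncurry E F G).
Proof. by move=> h; apply: tens_ext => e x; rewrite tuncurryE tcurryE. Qed.

Lemma tuncurryK E F G : cancel (@tuncurry E F G) (tcurry E F G).
Proof.
move=> g; apply/lfunP => e; apply: (bij_inj (tens_hom_bij F G)).
by apply/lfunP => x; rewrite tcurryE tuncurryE.
Qed.

(** Both sides are linear in [z], and on [phi *t v] each equals [phi (b x) *: c v]. Besides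
    naturality of currying, this gives the splitting of a tensor along a projection. *)
Lemma tens_hom_map F G F1 G1 (b : 'Hom(F1, F)) (c : 'Hom(G, G1)) z x :
  tens_hom F1 G1 (tmap (transpose b) c z) x = c (tens_hom F G z (b x)).
Proof.
have L : linear (fun h : 'Hom(F, G) => (c \o h \o b)%VF).
  by move=> a h h'; apply/lfunP => y;
     rewrite !(comp_lfunE, add_lfunE, scale_lfunE, linear_lfun).
have : (tens_hom F1 G1 \o tmap (transpose b) c)%VF =
       (linfun (fun h : 'Hom(F, G) => (c \o h \o b)%VF) \o tens_hom F G)%VF.
  apply: tens_ext => phi v; apply/lfunP => y.
  by rewrite !comp_lfunE (linfun_linear L) tmapE !comp_lfunE !tens_homE
             transposeE linearZ /=.
move/lfunP/(_ z); rewrite !comp_lfunE => ->.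
by rewrite (linfun_linear L) !comp_lfunE.
Qed.

Lemma tcurry_natural E F G E1 F1 G1 (a : 'Hom(E1, E)) (b : 'Hom(F1, F))
    (c : 'Hom(G, G1)) (h : 'Hom(tens E F, G)) :
  tcurry E1 F1 G1 (c \o h \o tmap a b)%VF =
  (tmap (transpose b) c \o tcurry E F G h \o a)%VF.
Proof.
apply/lfunP => e; apply: (bij_inj (tens_hom_bij F1 G1)); apply/lfunP => x.
by rewrite tcurryE !comp_lfunE tmapE tens_hom_map tcurryE.
Qed.

(** * Tensor powers of the dual, and annihilators *)

Lemma tpow_dual_bij n E : bijective (tpow_dual n E).
Proof.
elim: n => [|n IH].
  exists (fun psi : 'Hom(K^o, K^o) => psi 1) => [a|psi].
    by rewrite tpow_dual0 mulr1.
  by apply/lfunP => b; rewrite tpow_dual0 -{2}[b]mulr1 [RHS]linearZ; apply: mulrC.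
(* At [n.+1], [tpow_dual] is [tmap \1 (tpow_dual n E)], followed by [tens_hom] into
   ['Hom(E, dual (tpow n E))], followed by [un]. All three are bijective; [cu] inverts [un]. *)
pose un (g : 'Hom(E, dual (tpow n E))) : dual (tens E (tpow n E)) :=
  tlift (fun e s => (g e : 'Hom(_, K^o)) s).
have unE g e s : (un g : 'Hom(_, K^o)) (e *t s) = (g e : 'Hom(_, K^o)) s.
  apply: tliftE; split=> [u|v] a y y'; first exact: linear_lfun.
  by rewrite linear_lfun add_lfunE scale_lfunE.
pose cu (psi : 'Hom(tens E (tpow n E), K^o)) : 'Hom(E, dual (tpow n E)) :=
  linfun (fun e => linfun (fun s => psi (e *t s))).
have cuE psi e s : (cu psi e : 'Hom(_, K^o)) s = psi (e *t s).
  have L2 e' : linear (fun s => psi (e' *t s)).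
    by move=> a p q; rewrite tensor_linr linear_lfun.
  rewrite /cu (linfun_linear (f := fun e => linfun _)) ?linfun_linear // => a p q.
  apply/lfunP => t; rewrite add_lfunE scale_lfunE !linfun_linear //.
  by rewrite tensor_linl linear_lfun.
have bij_un : bijective un.
  exists cu => [g|psi].
    by apply/lfunP => e; apply/lfunP => s; rewrite cuE unE.
  by apply: tens_ext => e s; rewrite unE cuE.
have bij1 : bijective (\1 : 'End(dual E))%VF by exists id => x; rewrite id_lfunE.
apply: eq_bij (bij_comp bij_un (bij_comp (tens_hom_bij E (dual (tpow n E)))
                                         (tmap_bij bij1 IH))) _ _ => z /=.
have Lun : linear un.
  move=> a g g'; apply/lfunP => x; rewrite add_lfunE scale_lfunE.
  by apply: tlift_funD => e s; rewrite !add_lfunE !scale_lfunE.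
rewrite -(linfun_linear Lun) -!comp_lfunE.
congr (fun_of_lfun _ z); apply: tens_ext => phi w; apply: tens_ext => e s.
rewrite tpow_dualS !comp_lfunE linfun_linear // tmapE id_lfunE unE tens_homE.
by rewrite scale_lfunE.
Qed.

Lemma mem_tens_hom V W (A : {vspace V}) (B : {vspace W}) (z : tens (dual V) W) :
  reflect (forall x, x \in A -> tens_hom V W z x \in B)
          (z \in (tensv (annih A) fullv + tensv fullv B)%VS).
Proof.
apply: (iffP idP) => [/memv_addP[y yA [t tB ->]] x xA|zAB].
  pose ex := linfun (fun h : 'Hom(V, W) => h x).
  have exE h : ex h = h x.
    by apply: linfun_linear => a g g'; rewrite add_lfunE scale_lfunE.
  rewrite linearD add_lfunE memvD //.
    suff /subvP/(_ y yA): (tensv (annih A) fullv <= (ex \o tens_hom V W) @^-1: B)%VS.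
      by rewrite -memv_preim comp_lfunE exE.
    apply: tensv_sub => phi w /annihP phiA _.
    by rewrite -memv_preim comp_lfunE exE tens_homE phiA // scale0r mem0v.
  suff /subvP/(_ t tB): (tensv fullv B <= (ex \o tens_hom V W) @^-1: B)%VS.
    by rewrite -memv_preim comp_lfunE exE.
  apply: tensv_sub => phi w _ wB.
  by rewrite -memv_preim comp_lfunE exE tens_homE memvZ.
pose p : 'End(V) := projv A.
(* As [p] fixes [A], the first summand is built from functionals vanishing on [A]; as [p] maps into
   [A], the second has values in [B]. *)
have -> : z = tmap (transpose (\1 - p)%VF) \1%VF z + tmap (transpose p) \1%VF z.
  apply: (bij_inj (tens_hom_bij V W)); apply/lfunP => x.
  rewrite linearD add_lfunE !tens_hom_map !id_lfunE -linearD /=.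
  by rewrite add_lfunE opp_lfunE id_lfunE subrK.
apply: memv_add.
  rewrite memv_preim; apply: mem_tens => phi w; rewrite -memv_preim tmapE.
  apply: memv_tens; last exact: memvf.
  apply/annihP => x xA.
  by rewrite transposeE add_lfunE opp_lfunE id_lfunE projv_id // subrr linear0.
(* Restricting the codomain to [B] makes the second summand come from a tensor [y] over
   [subvs_of B]. *)
pose k : 'Hom(V, subvs_of B) := linfun (vsproj B \o (tens_hom V W z \o p)%VF).
have kE x : k x = vsproj B (tens_hom V W z (p x)).
  by rewrite lfunE /= comp_lfunE.
have [y yK] : exists y, tens_hom V (subvs_of B) y = k.
  by have [g _ gK] := tens_hom_bij V (subvs_of B); exists (g k).
have -> : tmap (transpose p) \1%VF z = tmap \1%VF (linfun (vsval : subvs_of B -> W)) y.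
  apply: (bij_inj (tens_hom_bij V W)); apply/lfunP => x.
  have -> : \1%VF = transpose \1%VF :> 'End(dual V).
    by apply/lfunP => phi; apply/lfunP => x'; rewrite transposeE !id_lfunE.
  rewrite !tens_hom_map !id_lfunE yK kE vsval_lfunE vsprojK //.
  by apply: zAB; rewrite memv_proj.
rewrite memv_preim; apply: mem_tens => phi w; rewrite -memv_preim tmapE.
by rewrite vsval_lfunE memv_tens ?memvf ?subvsP.
Qed.

(** The relations of [hdual] are a preimage under the isomorphism [tpow_dual]; transport along it
    and its inverse reduces the claim to [mem_tens_hom]. *)
Lemma mem_tens_hom_dual n F G (A : {vspace tpow n F}) (B : {vspace tpow n G})
    (z : tens (tpow n (dual F)) (tpow n G)) :
  reflect (forall x, x \in A ->
             tens_hom (tpow n F) (tpow n G)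
               (tmap (tpow_dual n F) \1%VF z) x \in B)
          (z \in (tensv (tpow_dual n F @^-1: annih A) fullv + tensv fullv B)%VS).
Proof.
have [inv invK Kinv] := bijective_lfun (tpow_dual_bij n F).
suff -> : (z \in (tensv (tpow_dual n F @^-1: annih A) fullv + tensv fullv B)%VS) =
          (tmap (tpow_dual n F) \1%VF z \in
             (tensv (annih A) fullv + tensv fullv B)%VS).
  exact: mem_tens_hom.
set S := (_ + _)%VS; set T := (_ + _)%VS.
have ST : (S <= tmap (tpow_dual n F) \1 @^-1: T)%VS.
  rewrite subv_add; apply/andP; split; apply: tensv_sub => u v.
    rewrite -!memv_preim => uA _; rewrite tmapE id_lfunE.
    by apply: (subvP (addvSl _ _)); rewrite memv_tens ?memvf.
  move=> _ vB; rewrite -memv_preim tmapE id_lfunE.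
  by apply: (subvP (addvSr _ _)); rewrite memv_tens ?memvf.
have TS : (T <= tmap inv \1 @^-1: S)%VS.
  rewrite subv_add; apply/andP; split; apply: tensv_sub => u v.
    move=> uA _; rewrite -memv_preim tmapE id_lfunE.
    by apply: (subvP (addvSl _ _)); rewrite memv_tens ?memvf // -memv_preim Kinv.
  move=> _ vB; rewrite -memv_preim tmapE id_lfunE.
  by apply: (subvP (addvSr _ _)); rewrite memv_tens ?memvf.
apply/idP/idP => [zS|zT].
  by rewrite memv_preim; exact: (subvP ST).
have := subvP TS _ zT; rewrite -memv_preim tmap_cancel // => x.
by rewrite !id_lfunE.
Qed.

(** Pairing factor by factor or all at once gives, on pure tensors, the same product of the
    phi_i(x_i) times the tensor of the vectors of [G]. In the induction, [tensorZ] merges the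
    scalars of head and tail. *)
Lemma tens_eval_tpow n F G (z : tens (tpow n (dual F)) (tpow n G)) t :
  tpow_map n (tens_eval F G)
    (tpow_shuffle n (tens (dual F) G) F (tpow_shuffle n (dual F) G z *t t)) =
  tens_hom (tpow n F) (tpow n G) (tmap (tpow_dual n F) \1%VF z) t.
Proof.
suff H : (tpow_map n (tens_eval F G) \o tpow_shuffle n (tens (dual F) G) F \o
            tmap (tpow_shuffle n (dual F) G) \1)%VF =
         (tens_eval (tpow n F) (tpow n G) \o
            tmap (tmap (tpow_dual n F) \1) \1)%VF.
  by have /lfunP/(_ (z *t t)) := H; rewrite !comp_lfunE !tmapE tens_evalE !id_lfunE.
elim: n {z t} => [|n IH].
  apply: tens_ext3 => a c b.
  rewrite !comp_lfunE !tmapE tens_evalE !id_lfunE !tpow_shuffle0 tens_homE tpow_dual0.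
  exact: mulrAC.
apply: tens_ext6 => phi w u s e t.
rewrite !comp_lfunE !tmapE tens_evalE !id_lfunE !tpow_shuffleS tpow_mapS.
rewrite tens_evalE !tens_homE tpow_dualS.
have /lfunP/(_ ((w *t s) *t t)) := IH.
rewrite !comp_lfunE !tmapE tens_evalE !id_lfunE tens_homE => ->.
exact: tensorZ.
Qed.

End TensorMaps.

(** * The correspondence of morphisms *)

Lemma is_halg_hom_tcurry (K : fieldType) (N : nat) (A B C : halg K N)
    (f : 'Hom(tens (hgen A) (hgen B), hgen C)) :
  @is_halg_hom K N A (hcirc (hdual B) C) (tcurry (hgen A) (hgen B) (hgen C) f) =
  @is_halg_hom K N (hbullet A B) C f.
Proof.
set g := tcurry _ _ _ f.
have fE r t : tpow_map N f (tpow_shuffle N (hgen A) (hgen B) (r *t t)) =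
    tpow_map N (tens_eval (hgen B) (hgen C))
      (tpow_shuffle N (tens (dual (hgen B)) (hgen C)) (hgen B)
         (tpow_map N g r *t t)).
  rewrite -[f in LHS]tcurryK tpow_map_comp comp_lfunE; congr (fun_of_lfun _ _).
  have /lfunP/(_ (r *t t)) := tpow_shuffle_map N g (\1 : 'End(hgen B))%VF.
  by rewrite !comp_lfunE tmapE tpow_map_id id_lfunE.
apply/is_halg_homP/is_halg_homP => [gP _ /memv_imgP[x xAB ->]|fP r rA].
  suff /subvP/(_ x xAB): (tensv (hrel A) (hrel B) <=
      (tpow_map N f \o tpow_shuffle N (hgen A) (hgen B)) @^-1: hrel C)%VS.
    by rewrite -memv_preim comp_lfunE.
  apply: tensv_sub => r t rA tB; rewrite -memv_preim comp_lfunE fE.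
  have /memv_imgP[z zS ->] := gP r rA.
  by rewrite tens_eval_tpow; apply: (mem_tens_hom_dual _ _ _ zS).
(* This [z] is an arbitrary preimage; its values on [hrel B] are those of f^N on pi_N(r (x) t), so
   they lie in [hrel C]. *)
have /memv_imgP[z _ zE] : tpow_map N g r \in
    limg (tpow_shuffle N (dual (hgen B)) (hgen C)).
  by rewrite tpow_shuffle_surj memvf.
rewrite zE memv_img //; apply/mem_tens_hom_dual => t tB.
by rewrite -tens_eval_tpow -zE -fE fP // memv_img // memv_tens.
Qed.

Theorem theorem2 (K : fieldType) (N : nat) (N_ge2 : (2 <= N)%N) :
  [/\ (* tcurry is an isomorphism of vector spaces, functorial in E, F, G *)
      forall E F G : vectType K, bijective (tcurry E F G),
      forall (E F G E1 F1 G1 : vectType K)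
             (a : 'Hom(E1, E)) (b : 'Hom(F1, F)) (c : 'Hom(G, G1))
             (h : 'Hom(tens E F, G)),
        tcurry E1 F1 G1 (c \o h \o tmap a b)%VF
        = (tmap (transpose b) c \o tcurry E F G h \o a)%VF
    & (* it induces a functorial isomorphism of sets of morphisms *)
      exists Phi : forall A B C : halg K N,
          halg_hom (hbullet A B) C -> halg_hom A (hcirc (hdual B) C),
        [/\ forall (A B C : halg K N) (f : halg_hom (hbullet A B) C),
              hfun (Phi A B C f)
              = tcurry (hgen A) (hgen B) (hgen C) (hfun f),
            forall A B C : halg K N, bijective (Phi A B C)
          & forall (A B C A1 B1 C1 : halg K N)
                   (a : halg_hom A1 A) (b : halg_hom B1 B) (c : halg_hom C C1)
                   (f : halg_hom (hbullet A B) C),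
              Phi A1 B1 C1 (hcomp c (hcomp f (hbullet_map a b)))
              = hcomp (hcirc_map (hdual_map b) c) (hcomp (Phi A B C f) a)]].
Proof.
split=> [E F G|*|]; last 1 first.
- have curP (A B C : halg K N) (f : halg_hom (hbullet A B) C) :
      @is_halg_hom K N A (hcirc (hdual B) C) (tcurry _ _ _ (hfun f)).
    by rewrite is_halg_hom_tcurry hfunP.
  exists (fun A B C f => HalgHom (curP A B C f)).
  split=> [//|A B C|A B C A1 B1 C1 a b c f].
    (* Since [g] is the curried form of [tuncurry g], the same equivalence read backwards provides
       the inverse. *)
    have uncP (g : halg_hom A (hcirc (hdual B) C)) :
        @is_halg_hom K N (hbullet A B) C (tuncurry (hfun g)).
      by rewrite -is_halg_hom_tcurry tuncurryK hfunP.
    exists (fun g => HalgHom (uncP g)) => f; apply: val_inj.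
      exact: tcurryK.
    exact: tuncurryK.
  by apply: val_inj; rewrite /= !comp_lfunA tcurry_natural.
- by exists (@tuncurry K E F G); [apply: tcurryK | apply: tuncurryK].
exact: tcurry_natural.
Qed.
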